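(* Let $N\ge2$, $a=\frac1N$, and let the initial data satisfy $x_i(0)<x_{i+1}(0)$ for $i=1,\dots,N$. Then the ODE system $$\frac{dx_i}{dt}=\frac1a\Bigl(\frac{f_{i+1}-f_i}{x_{i+1}-x_i}-\frac{f_i-f_{i-1}}{x_i-x_{i-1}}\Bigr),\quad i=1,\dots,N,$$ $$f_i=-\frac2L\sum_{j\ne i}\frac{a}{x_j-x_i}+\Bigl(\frac1{x_{i+1}-x_i}-\frac1{x_i-x_{i-1}}\Bigr)+\Bigl(\frac{a^2}{(x_{i+1}-x_i)^3}-\frac{a^2}{(x_i-x_{i-1})^3}\Bigr),$$ has a global in time solution.
   Context: $L>0$ is fixed. The unknowns are $x_1(t),\dots,x_N(t)$, extended to all indices $i\in\mathbb{Z}$ by $x_{i+N}(t)=x_i(t)+L$ (hence $f_{i+N}=f_i$). The sum $\sum_{j\ne i}$ runs over $j\in\mathbb{Z}\setminus\{i\}$ and is understood through symmetric summation over periods, using $\sum_{k\in\mathbb{Z}}\frac1{x+kL}=\frac{\pi}{L}\cot(\frac{\pi}{L}x)$; that is, $\sum_{j\neq i}\frac{a}{x_j-x_i}=\sum_{1\le j\le N,\,j\ne i}a\frac{\pi}{L}\cot\bigl(\frac{\pi}{L}(x_j-x_i)\bigr)$ for $1\le i\le N$. A global in time solution is one defined for all $t\ge0$. *)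

(* Defs.v *)
From mathcomp Require Import all_boot all_order all_algebra.
From mathcomp Require Import all_classical all_reals all_analysis.
Import Order.TTheory GRing.Theory Num.Theory.
Import numFieldNormedType.Exports.

Set Implicit Arguments.
Unset Strict Implicit.
Unset Printing Implicit Defensive.

Local Open Scope classical_set_scope.
Local Open Scope ring_scope.

Definition cot (R : realType) (x : R) : R := cos x / sin x.

(* Derivative relative to D: two-sided at interior points of D, one-sided at
   t = 0 when D = [0, +oo[. *)
Definition has_derivative_in (R : realType) (D : set R) (f : R -> R) (t l : R)
  : Prop :=
  (fun s => (f s - f t) / (s - t)) @ within D t^' --> l.

(* A configuration is a family (x_i) indexed by all integers. *)
Definition quasi_periodic (R : realType) (L : R) (N : nat) (x : int -> R)
  : Prop :=
  forall i : int, x (i + N%:Z) = x i + L.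

Definition ordered (R : realType) (N : nat) (x : int -> R) : Prop :=
  forall i : int, 1 <= i <= N%:Z -> x i < x (i + 1).

(* The symmetrically summed series \sum_(j in Z, j <> i) a / (x_j - x_i), in
   the closed form provided by \sum_k 1 / (y + k L) = pi/L cot (pi/L y). For
   1 <= i <= N the side condition on j just says j <> i; stating it modulo N
   gives the N-periodic extension to all integers i. The terms with
   j = i mod N, j <> i, cancel in pairs. *)
Definition interaction_sum (R : realType) (L a : R) (N : nat) (x : int -> R)
    (i : int) : R :=
  \sum_(1 <= j < N.+1 | (j%:Z != i %[mod N%:Z])%Z)
    a * (pi / L * cot (pi / L * (x j%:Z - x i))).

Definition force (R : realType) (L a : R) (N : nat) (x : int -> R) (i : int) : R :=
  - (2 / L) * interaction_sum L a N x i
  + (1 / (x (i + 1) - x i) - 1 / (x i - x (i - 1)))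
  + (a ^+ 2 / (x (i + 1) - x i) ^+ 3 - a ^+ 2 / (x i - x (i - 1)) ^+ 3).

Definition velocity (R : realType) (L a : R) (N : nat) (x : int -> R) (i : int)
  : R :=
  1 / a * ((force L a N x (i + 1) - force L a N x i) / (x (i + 1) - x i)
           - (force L a N x i - force L a N x (i - 1)) / (x i - x (i - 1))).

(* Since 1 / 0 = 0 here, a solution is explicitly required to stay in the
   phase space of ordered configurations, where no denominator vanishes and
   every cotangent is taken away from its poles. *)
Definition global_solution (R : realType) (L a : R) (N : nat) (x0 : int -> R)
    (x : int -> R -> R) : Prop :=
  [/\ forall i : int, x i 0 = x0 i,
      forall t : R, 0 <= t -> quasi_periodic L N (fun i => x i t),
      forall t : R, 0 <= t -> ordered N (fun i => x i t) &
      forall (t : R) (i : int), 0 <= t -> 1 <= i <= N%:Z ->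
        has_derivative_in [set s | 0 <= s] (x i) t
          (velocity L a N (fun k => x k t) i)].

(* Main.v *)
Require Import Defs.
From mathcomp Require Import all_boot all_order all_algebra.
From mathcomp Require Import all_classical all_reals all_analysis.
From mathcomp Require Import ring lra zify.
Import Order.TTheory GRing.Theory Num.Theory.
Import numFieldNormedType.Exports.

Local Open Scope classical_set_scope.
Local Open Scope ring_scope.

(** The system is a gradient flow for a degenerate metric. Let [h i] be the gap
[x (i + 1) - x i]. The forces [f i] are the partial derivatives of the energy

    sum of (- ln (h i) + a ^+ 2 / (2 * h i ^+ 2)) over one period
    + (2 * a / L) * sum of ln |sin (pi / L * (x j - x i))| over pairs i < j,

and the velocity is [a^-1] times the discrete divergence of
[(f (i + 1) - f i) / h i]. Summing by parts, the energy decreases at the rate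
[a^-1] times the sum of [(f (i + 1) - f i) ^+ 2 / h i]
([is_derive_energy], [energy_dissipation]).

The energy prevents collisions. The pair terms tend to minus infinity when two
particles meet, but only logarithmically, while the repulsion
[a ^+ 2 / (2 * h ^+ 2)] of the smallest gap is of a higher order. So a bound on
the energy bounds all the gaps from below ([gaps_of_energy_le]). On
configurations whose gaps are bounded below the velocity is bounded and
Lipschitz, and nothing can stop the solution.

To avoid local solutions and their maximal intervals of existence, the vector
field is truncated first: [1 / h] becomes [1 / max h d] and the cotangent is
written as [cos * sin / sin ^+ 2] with the denominator replaced by its maximum
with a positive constant. The truncated field is globally bounded and Lipschitz
([controlled_trunc_velocity]), so it has a solution for all times
([global_picard], [truncated_solution]). With [d] equal to half the lower bound
on gaps given by the initial energy, that solution never reaches the region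
where the truncation acts ([gaps_persist]), so it solves the original
system. *)

(** * Estimates from derivatives, primitives, geometric convergence *)

Lemma ndecr_of_derive {R : realType} (F dF : R -> R) (a b : R) :
  a <= b -> (forall t : R, a <= t <= b -> is_derive t 1 F (dF t)) ->
  (forall t : R, a <= t <= b -> 0 <= dF t) -> F a <= F b.
Proof.
move=> ab dfF dF0.
have cF : {within `[a, b], continuous F}.
  apply: derivable_within_continuous => t; rewrite in_itv/= => tab.
  by have [] := dfF t tab.
have [|c] := @MVT_segment R F dF a b ab _ cF.
  by move=> t; rewrite in_itv/= => /andP[/ltW at_ /ltW tb]; apply: dfF; rewrite at_.
rewrite in_itv/= => /dF0 c0 FE.
by rewrite -subr_ge0 FE mulr_ge0 // subr_ge0.
Qed.

(** The differential form of an integral estimate: it is what lets every bound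
on the Picard iterates be read off from a bound on their derivatives. *)
Lemma norm_le_of_derive {R : realType} (F dF H dH : R -> R) (b : R) :
  0 <= b ->
  (forall t : R, 0 <= t <= b -> is_derive t 1 F (dF t)) ->
  (forall t : R, 0 <= t <= b -> is_derive t 1 H (dH t)) ->
  (forall t : R, 0 <= t <= b -> `|dF t| <= dH t) ->
  `|F 0| <= H 0 -> `|F b| <= H b.
Proof.
move=> b0 FF HH le_dF; rewrite !ler_norml => /andP[l u]; apply/andP; split.
- have : (H + F) 0 <= (H + F) b.
    apply: (@ndecr_of_derive R (H + F) (fun t => dH t + dF t)) => // t tb.
      by apply: is_deriveD; [exact: HH|exact: FF].
    by have := le_dF t tb; rewrite ler_norml => /andP[+ _]; lra.
  by rewrite /= !fctE; lra.
- have : (H - F) 0 <= (H - F) b.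
    apply: (@ndecr_of_derive R (H - F) (fun t => dH t - dF t)) => // t tb.
      by apply: is_deriveB; [exact: HH|exact: FF].
    by have := le_dF t tb; rewrite ler_norml => /andP[_ +]; lra.
  by rewrite /= !fctE; lra.
Qed.

Lemma lipschitz_of_derive {R : realType} (F dF : R -> R) (a B : R) :
  (forall t : R, a <= t -> is_derive t 1 F (dF t)) ->
  (forall t : R, a <= t -> `|dF t| <= B) ->
  forall s t, a <= s -> a <= t -> `|F s - F t| <= B * `|s - t|.
Proof.
move=> FF dFB.
suff W s t : a <= s -> s <= t -> `|F s - F t| <= B * `|s - t|.
  move=> s t s0 t0; have [st|/ltW ts] := leP s t; first exact: W.
  by rewrite distrC (distrC s); exact: W.
move=> s0 st.
have cF : {within `[s, t], continuous F}.
  apply: derivable_within_continuous => u; rewrite in_itv/= => /andP[su _].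
  by have [] := FF u (le_trans s0 su).
have [|c] := @MVT_segment R F dF s t st _ cF.
  move=> u; rewrite in_itv/= => /andP[/ltW su _].
  exact: FF (le_trans s0 su).
rewrite in_itv/= => /andP[sc _] FE.
rewrite distrC FE normrM (distrC s) ler_wpM2r //.
exact: dFB (le_trans s0 sc).
Qed.

(** The integration starts at [-1] instead of [0] so that [t = 0] is interior:
the primitive is then differentiable on both sides at the initial time. *)
Definition primitive {R : realType} (f : R -> R) (t : R) : R :=
  (\int[@lebesgue_measure R]_(s in `[-1, t]) f s) -
  (\int[@lebesgue_measure R]_(s in `[-1, 0]) f s).

Lemma primitive0 {R : realType} (f : R -> R) : primitive f 0 = 0.
Proof. by rewrite /primitive subrr. Qed.

Lemma is_derive_primitive {R : realType} (f : R -> R) (t : R) :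
  continuous f -> 0 <= t -> is_derive t 1 (primitive f) (f t).
Proof.
move=> cf t0.
have t1 : -1 < t by lra.
have tu : t < t + 1 by lra.
have intf : (@lebesgue_measure R).-integrable `[-1, t + 1] (EFin \o f).
  apply: continuous_compact_integrable; first exact: segment_compact.
  exact: continuous_subspaceT.
have [d1 d2] := @continuous_FTC1_closed R f (-1) t (t + 1) tu intf t1 (cf t).
have dF : is_derive t 1 (fun t => \int[@lebesgue_measure R]_(s in `[-1, t]) f s) (f t).
  by rewrite -d2 derive1E; exact: DeriveDef.
have := is_deriveB dF
  (is_derive_cst (\int[@lebesgue_measure R]_(s in `[-1, 0]) f s) t 1).
by rewrite subr0; exact.
Qed.

Lemma lipschitz_continuous {R : realType} (f : R -> R) (B : R) :
  (forall s t, `|f s - f t| <= B * `|s - t|) -> continuous f.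
Proof.
move=> fB t; apply/cvgrPdist_le => e e0.
have B0 : 0 < `|B| + 1 by rewrite ltr_wpDl.
near=> s.
apply: le_trans (fB _ _) _.
have : `|t - s| <= e / (`|B| + 1).
  near: s; apply: cvgr_dist_le; first exact: cvg_id.
  by rewrite divr_gt0.
rewrite ler_pdivlMr // mulrC; apply: le_trans; rewrite ler_wpM2r //.
by rewrite (le_trans (ler_norm B)) // lerDl.
Unshelve. all: by end_near. Qed.

(** The explicit remainder is kept because the limit of the Picard iterates has
to be compared with them, with a bound of the same shape as their steps. *)
Lemma cvg_geometric_steps {R : realType} (u : nat -> R) (C : R) :
  (forall n, `|u n.+1 - u n| <= C * (1 / 2) ^+ n) ->
  cvgn u /\ forall n, `|limn u - u n| <= 2 * C * (1 / 2) ^+ n.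
Proof.
move=> uC.
have tail n k : `|u (n + k)%N - u n| <= 2 * C * (1 / 2) ^+ n - 2 * C * (1 / 2) ^+ (n + k).
  elim: k => [|k IH]; first by rewrite addn0 !subrr normr0.
  have := uC (n + k)%N.
  rewrite addnS.
  have -> : u (n + k).+1 - u n = (u (n + k).+1 - u (n + k)%N) + (u (n + k)%N - u n) by ring.
  move=> h; apply: le_trans (ler_normD _ _) _.
  apply: le_trans (lerD h IH) _; rewrite exprS; lra.
have C0 : 0 <= C by have := uC 0%N; rewrite expr0 mulr1; apply: le_trans.
have q0 n : 0 <= C * (1 / 2) ^+ n by rewrite mulr_ge0 // exprn_ge0.
have tail' n k : `|u (n + k)%N - u n| <= 2 * C * (1 / 2) ^+ n.
  by apply: le_trans (tail n k) _; have := q0 (n + k)%N; lra.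
have qcvg : (fun n => 2 * C * (1 / 2 : R) ^+ n) @ \oo --> 0.
  rewrite -(mulr0 (2 * C)); apply: cvgMr; apply: cvg_expr.
  by rewrite ger0_norm; lra.
have cu : cvgn u.
  apply: cauchy_cvg; apply/cauchy_ballP => e e0; rewrite near_map2 /=.
  have e2 : 0 < e / 2 by lra.
  move/cvgrPdist_lt : (qcvg) => /(_ _ e2)[n _ /(_ n (leqnn n))].
  rewrite sub0r normrN ger0_norm; last by rewrite -mulrA mulr_ge0.
  move=> ne.
  near=> p q.
  have np : (n <= p)%N by near: p; exists n.
  have nq : (n <= q)%N by near: q; exists n.
  rewrite -ball_normE /=.
  have -> : u p - u q = (u p - u n) - (u q - u n) by ring.
  rewrite -(subnKC np) -(subnKC nq).
  apply: le_lt_trans (ler_normB _ _) _.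
  by have := tail' n (p - n)%N; have := tail' n (q - n)%N; lra.
split=> // n.
have cun : `|u k - u n| @[k --> \oo] --> `|limn u - u n|.
  by apply: cvg_norm; apply: cvgB => //; exact: cvg_cst.
apply: (cvgr_to_le cun); exists n => // k /= nk.
by rewrite -(subnKC nk).
Unshelve. all: by end_near. Qed.

(** * Global Picard iteration for bounded Lipschitz vector fields *)

(** The Lipschitz bound is for the sup distance, phrased through an arbitrary
upper bound [m] of the distance; this avoids suprema, so that the index type
may be infinite. *)
Definition bounded_lipschitz {R : realType} {I : Type}
    (G : (I -> R) -> I -> R) (B K : R) : Prop :=
  (forall u i, `|G u i| <= B) /\
  (forall u v m, (forall j, `|u j - v j| <= m) ->
     forall i, `|G u i - G v i| <= K * m).

(** The integrand is frozen at its initial value for negative times, which makes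
it continuous on the whole line although [z] is only controlled for
nonnegative times. *)
Definition picard_step {R : realType} {I : Type} (G : (I -> R) -> I -> R)
    (y0 : I -> R) (z : I -> R -> R) : I -> R -> R :=
  fun i t => y0 i + primitive (fun s => G (fun j => z j (Num.max s 0)) i) t.

Definition time_lipschitz {R : realType} {I : Type} (B : R) (z : I -> R -> R) : Prop :=
  forall i s t, 0 <= s -> 0 <= t -> `|z i s - z i t| <= B * `|s - t|.

Lemma max_lipschitz {R : realType} (c s t : R) :
  `|Num.max s c - Num.max t c| <= `|s - t|.
Proof.
have h1 := ler_norm (s - t); have h2 := ler_norm (t - s).
rewrite distrC in h2.
by case: (leP s c) => ?; case: (leP t c) => ?; rewrite ler_norml; apply/andP; split; lra.
Qed.

Section picard.
Context {R : realType} {I : Type} (G : (I -> R) -> I -> R) (B K : R) (y0 : I -> R).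
Hypothesis GBK : bounded_lipschitz G B K.
Hypothesis B0 : 0 <= B.
Hypothesis K1 : 1 <= K.

Let step := picard_step G y0.

Lemma is_derive_picard_step z : time_lipschitz B z ->
  forall i (t : R), 0 <= t -> is_derive t 1 (step z i) (G (fun j => z j t) i).
Proof.
move=> zB i t t0.
have cG : continuous (fun s : R => G (fun j => z j (Num.max s 0)) i).
  apply: (@lipschitz_continuous _ _ (K * B)) => p q /=.
  rewrite -mulrA; apply: GBK.2 => j.
  apply: le_trans (zB j _ _ _ _) _; rewrite ?le_max ?lexx ?orbT //.
  by rewrite ler_wpM2l // max_lipschitz.
have := is_deriveD (is_derive_cst (y0 i) t 1) (is_derive_primitive _ _ cG t0).
by rewrite add0r max_l.
Qed.

Lemma picard_step_lipschitz z : time_lipschitz B z -> time_lipschitz B (step z).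
Proof.
move=> zB i; apply: (lipschitz_of_derive _ (fun t => G (fun j => z j t) i) 0).
  by move=> t; exact: is_derive_picard_step.
by move=> t _; exact: GBK.1.
Qed.

Lemma picard_step0 z i : step z i 0 = y0 i.
Proof. by rewrite /step /picard_step primitive0 addr0. Qed.

(** In the weight [expR (2 * K * t)] the Picard map halves distances: integrating
[K * C * expR (2 * K * t)] gains the factor [1 / (2 * K)]. This is what makes
the iteration converge for all times at once. *)
Lemma picard_step_contraction z w (C : R) :
  0 <= C -> time_lipschitz B z -> time_lipschitz B w ->
  (forall t, 0 <= t -> forall i, `|z i t - w i t| <= C * expR (2 * K * t)) ->
  forall t, 0 <= t -> forall i,
    `|step z i t - step w i t| <= C / 2 * expR (2 * K * t).
Proof.
move=> C0 zB wB zw t t0 i.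
apply: (norm_le_of_derive (fun t => step z i t - step w i t)
  (fun t => G (fun j => z j t) i - G (fun j => w j t) i)
  (fun t => C / 2 * expR (2 * K * t))
  (fun t => K * (C * expR (2 * K * t)))) => //.
- move=> s /andP[s0 _].
  exact: is_deriveB (is_derive_picard_step z zB i s s0) (is_derive_picard_step w wB i s s0).
- move=> s _.
  have dl : is_derive s 1 (fun t : R => 2 * K * t) (2 * K).
    by have := is_deriveZ (2 * K) (is_derive_id s 1); rewrite /GRing.scale /= mulr1.
  have de : is_derive s 1 (fun t : R => expR (2 * K * t)) (expR (2 * K * s) * (2 * K)).
    exact: (is_derive1_comp (is_derive_expR _) dl).
  have := is_deriveZ (C / 2) de.
  rewrite /GRing.scale /=.
  by have -> : C / 2 * (expR (2 * K * s) * (2 * K)) = K * (C * expR (2 * K * s)) by field.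
- by move=> s /andP[s0 _]; apply: GBK.2 => j; exact: zw.
- by rewrite !picard_step0 subrr normr0 mulr_ge0 ?expR_ge0 // divr_ge0.
Qed.

(** Every iterate is [B]-Lipschitz in time, hence so is their pointwise limit,
and the Picard map can be applied to that limit. *)
Lemma global_picard :
  exists y : I -> R -> R, [/\ forall i, y i 0 = y0 i,
    forall i (t : R), 0 <= t -> is_derive t 1 (y i) (G (fun j => y j t) i) &
    time_lipschitz B y].
Proof.
pose z n := iter n step (fun i _ => y0 i).
have zB n : time_lipschitz B (z n).
  elim: n => [|n IH]; last exact: picard_step_lipschitz.
  by move=> i s t _ _; rewrite subrr normr0 mulr_ge0.
have zz n t : 0 <= t -> forall i,
    `|z n.+1 i t - z n i t| <= B * (1 / 2) ^+ n * expR (2 * K * t).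
  elim: n t => [|n IH] t t0 i; last first.
    rewrite exprS mulrA (mulrAC _ (1 / 2)) mulrA mulr1.
    apply: (picard_step_contraction (z n.+1) (z n) _ _ (zB n.+1) (zB n)) => //.
    by rewrite mulr_ge0 // exprn_ge0.
  rewrite expr0 mulr1.
  have := lipschitz_of_derive _ _ 0 _ (is_derive_picard_step _ (zB 0%N) i)
     (fun s _ => GBK.1 _ _) t 0 t0 (lexx _).
  rewrite -/(step _) picard_step0 subr0 (ger0_norm t0) => /le_trans; apply.
  rewrite ler_wpM2l //; apply: le_trans (expR_ge1Dx _).
  have : t <= K * t by rewrite -{1}(mul1r t) ler_wpM2r.
  lra.
have zz' i t : 0 <= t -> forall n,
    `|z n.+1 i t - z n i t| <= B * expR (2 * K * t) * (1 / 2) ^+ n.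
  by move=> t0 n; rewrite mulrAC; exact: zz.
pose y i t := limn (fun n => z n i t).
have yz n t : 0 <= t -> forall i,
    `|y i t - z n i t| <= 2 * B * (1 / 2) ^+ n * expR (2 * K * t).
  move=> t0 i; have [_ /(_ n)] := cvg_geometric_steps _ _ (zz' i t t0).
  by move=> /le_trans; apply; rewrite le_eqVlt; apply/orP; left; apply/eqP; ring.
have zy i t : 0 <= t -> z n i t @[n --> \oo] --> y i t.
  by move=> t0; have [] := cvg_geometric_steps _ _ (zz' i t t0).
have yB : time_lipschitz B y.
  move=> i s t s0 t0.
  have cun : `|z n i s - z n i t| @[n --> \oo] --> `|y i s - y i t|.
    by apply: cvg_norm; apply: cvgB; exact: zy.
  by apply: (cvgr_to_le cun); near=> n; exact: zB.
have fixy t : 0 <= t -> forall i, step y i t = y i t.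
  move=> t0 i.
  have q0 n : 0 <= 2 * B * (1 / 2 : R) ^+ n by rewrite mulr_ge0 ?exprn_ge0 // mulr_ge0.
  have h n : `|step y i t - z n.+1 i t| <= 2 * B * (1 / 2) ^+ n / 2 * expR (2 * K * t).
    apply: picard_step_contraction => // s s0 j; exact: yz.
  (* [step y] is also the limit of the iterates, by contraction. *)
  have : z n.+1 i t @[n --> \oo] --> step y i t.
    apply: (@squeeze_cvgr _ _ _ _
      (fun n => step y i t - B * expR (2 * K * t) * (1 / 2) ^+ n)
      (fun n => step y i t + B * expR (2 * K * t) * (1 / 2) ^+ n)).
    - near=> n; have := h n; rewrite ler_norml => /andP[]; lra.
    - rewrite -[X in _ --> X]subr0 -(mulr0 (B * expR (2 * K * t))).
      apply: cvgB; first exact: cvg_cst.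
      by apply: cvgMr; apply: cvg_expr; rewrite ger0_norm; lra.
    - rewrite -[X in _ --> X]addr0 -(mulr0 (B * expR (2 * K * t))).
      apply: cvgD; first exact: cvg_cst.
      by apply: cvgMr; apply: cvg_expr; rewrite ger0_norm; lra.
  have := zy i t t0.
  rewrite -(@cvg_shiftS _ (fun n => z n i t)) => c1 c2.
  exact: (cvg_unique _ c2 c1).
(* The image of the limit is taken as the solution: it is differentiable by
   construction, on both sides even at time 0. *)
exists (step y); split=> [i|i t t0|]; first exact: picard_step0.
  have -> : (fun j => step y j t) = (fun j => y j t).
    by apply/funext => j; exact: fixy.
  exact: is_derive_picard_step.
exact: picard_step_lipschitz.
Unshelve. all: by end_near. Qed.

End picard.

(** * Bounded Lipschitz families of functions of a configuration *)

Section controlled.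
Context {R : realType}.
Implicit Types g h : (int -> R) -> int -> R.

Definition lipschitz_family g : Prop := exists2 K, 0 <= K &
  forall u v m, (forall j, `|u j - v j| <= m) -> forall i, `|g u i - g v i| <= K * m.

Definition bounded_family g : Prop := exists2 B, 0 <= B & forall u i, `|g u i| <= B.

(** The velocities are built from a few elementary functions by sums, products
and shifts; both conditions together are stable under these operations,
whereas a product of merely Lipschitz functions need not be Lipschitz. The
constants are uniform in the index, as required by Picard iteration. *)
Definition controlled g := bounded_family g /\ lipschitz_family g.

Lemma controlled_cst (c : int -> R) (C : R) :
  (forall i, `|c i| <= C) -> controlled (fun _ => c).
Proof.
move=> cC; split; first by exists C => //; exact: le_trans (cC 0).
by exists 0 => // u v m uv i; rewrite subrr normr0 mul0r.
Qed.

Lemma controlledD g h : controlled g -> controlled h ->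
  controlled (fun u i => g u i + h u i).
Proof.
move=> [[B B0 gB] [K K0 gK]] [[B' B0' hB] [K' K0' hK]]; split.
  exists (B + B'); first exact: addr_ge0.
  by move=> u i; apply: le_trans (ler_normD _ _) (lerD (gB _ _) (hB _ _)).
exists (K + K'); first exact: addr_ge0.
move=> u v m uv i; rewrite mulrDl.
have -> : g u i + h u i - (g v i + h v i) = (g u i - g v i) + (h u i - h v i) by ring.
exact: le_trans (ler_normD _ _) (lerD (gK _ _ _ uv _) (hK _ _ _ uv _)).
Qed.

Lemma controlledM g h : controlled g -> controlled h ->
  controlled (fun u i => g u i * h u i).
Proof.
move=> [[B B0 gB] [K K0 gK]] [[B' B0' hB] [K' K0' hK]]; split.
  exists (B * B'); first exact: mulr_ge0.
  by move=> u i; rewrite normrM ler_pM.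
exists (B * K' + K * B'); first by rewrite addr_ge0 // mulr_ge0.
move=> u v m uv i; rewrite mulrDl.
have -> : g u i * h u i - g v i * h v i =
  g u i * (h u i - h v i) + (g u i - g v i) * h v i by ring.
apply: le_trans (ler_normD _ _) _; rewrite !normrM -mulrA (mulrAC K) lerD //.
  by rewrite ler_pM //; exact: hK.
by rewrite ler_pM //; exact: gK.
Qed.

Lemma controlledZ (c : R) g : controlled g -> controlled (fun u i => c * g u i).
Proof. by apply: controlledM; exact: (controlled_cst _ `|c|). Qed.

Lemma controlledB g h : controlled g -> controlled h ->
  controlled (fun u i => g u i - h u i).
Proof.
move=> cg ch; under eq_fun do under eq_fun do rewrite -mulN1r.
exact: controlledD cg (controlledZ _ _ ch).
Qed.

Lemma controlled_reindex (s : int -> int) g :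
  controlled g -> controlled (fun u i => g u (s i)).
Proof.
move=> [[B B0 gB] [K K0 gK]]; split; first by exists B.
by exists K => // u v m uv i; exact: gK.
Qed.

Lemma controlled_if (b : int -> bool) g :
  controlled g -> controlled (fun u i => if b i then g u i else 0).
Proof.
move=> [[B B0 gB] [K K0 gK]]; split.
  by exists B => // u i; case: ifP => _ //; rewrite normr0.
exists K => // u v m uv i; case: ifP => _; first exact: gK.
by rewrite subrr normr0 mulr_ge0 //; exact: le_trans (uv 0).
Qed.

Lemma controlled_sum (r : seq nat) (P : nat -> int -> bool)
    (g : nat -> (int -> R) -> int -> R) :
  (forall j, controlled (g j)) ->
  controlled (fun u i => \sum_(j <- r | P j i) g j u i).
Proof.
move=> cg; elim: r => [|k r IH].
  under eq_fun do under eq_fun do rewrite big_nil.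
  by apply: (controlled_cst _ 0) => i; rewrite normr0.
suff -> : (fun u i => \sum_(j <- k :: r | P j i) g j u i) =
    (fun u i => (if P k i then g k u i else 0) + \sum_(j <- r | P j i) g j u i).
  by apply: controlledD => //; exact: controlled_if.
by apply/funext => u; apply/funext => i; rewrite big_cons; case: ifP; rewrite ?add0r.
Qed.

Lemma controlled_comp (phi : R -> R) (B K : R) g :
  0 <= K ->
  (forall s, `|phi s| <= B) -> (forall s t, `|phi s - phi t| <= K * `|s - t|) ->
  lipschitz_family g -> controlled (fun u i => phi (g u i)).
Proof.
move=> K0 phiB phiK [K' K0' gK]; split.
  by exists B => //; exact: le_trans (phiB 0).
exists (K * K'); first exact: mulr_ge0.
move=> u v m uv i; apply: le_trans (phiK _ _) _.
by rewrite -mulrA ler_wpM2l //; exact: gK.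
Qed.

Lemma lipschitz_difference (c : R) (s t : int -> int) :
  lipschitz_family (fun u i => c * (u (s i) - u (t i))).
Proof.
exists (2 * `|c|); first by rewrite mulr_ge0.
move=> u v m uv i.
have -> : c * (u (s i) - u (t i)) - c * (v (s i) - v (t i)) =
  c * ((u (s i) - v (s i)) - (u (t i) - v (t i))) by ring.
rewrite normrM (mulrC 2) -mulrA ler_wpM2l //.
apply: le_trans (ler_normB _ _) _.
by have := uv (s i); have := uv (t i); lra.
Qed.

Lemma controlled_precomp (r : (int -> R) -> int -> R) g :
  (forall u v m, (forall j, `|u j - v j| <= m) -> forall i, `|r u i - r v i| <= m) ->
  controlled g -> controlled (fun u => g (r u)).
Proof.
move=> rr [[B B0 gB] [K K0 gK]]; split; first by exists B.
by exists K => // u v m uv i; apply: gK => j; exact: rr.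
Qed.

End controlled.

(** * Truncation of the inverse and of the cotangent *)

Section truncation.
Context {R : realType}.
Implicit Types (d e s t : R).

Definition trunc_inv d s : R := (Num.max s d)^-1.

(** The denominator of [cos t * sin t / sin t ^+ 2] is bounded below, which
leaves a bounded Lipschitz function and, unlike a truncation of the argument,
preserves the period [pi]. *)
Definition trunc_cot e t : R := cos t * sin t * trunc_inv e (sin t ^+ 2).

Lemma controlled_trunc_inv d (g : (int -> R) -> int -> R) : 0 < d -> lipschitz_family g ->
  controlled (fun u i => trunc_inv d (g u i)).
Proof.
move=> d0; have m0 s : 0 < Num.max s d by rewrite lt_max d0 orbT.
have mB s : (Num.max s d)^-1 <= d^-1.
  by rewrite lef_pV2 // ?posrE // le_max lexx orbT.
apply: (controlled_comp _ d^-1 (d^-1 * d^-1)) => [|s|s t].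
- by rewrite mulr_ge0 // invr_ge0 ltW.
- by rewrite /trunc_inv ger0_norm // invr_ge0 ltW.
have -> : trunc_inv d s - trunc_inv d t =
    (Num.max s d)^-1 * (Num.max t d)^-1 * (Num.max t d - Num.max s d).
  by rewrite /trunc_inv; field; rewrite !gt_eqF.
rewrite normrM ger0_norm ?mulr_ge0 ?invr_ge0 ?(ltW (m0 _)) //.
rewrite ler_pM ?mulr_ge0 ?invr_ge0 ?(ltW (m0 _)) //.
  by rewrite ler_pM ?invr_ge0 ?(ltW (m0 _)).
by rewrite (distrC s); exact: max_lipschitz.
Qed.

Lemma sin_lipschitz s t : `|sin s - sin t| <= 1 * `|s - t|.
Proof.
apply: (@lipschitz_of_derive R sin cos (Num.min s t)); rewrite ?ge_min ?lexx ?orbT //.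
by move=> *; exact: cos_max.
Qed.

Lemma cos_lipschitz s t : `|cos s - cos t| <= 1 * `|s - t|.
Proof.
apply: (@lipschitz_of_derive R cos (fun t => - sin t) (Num.min s t));
  rewrite ?ge_min ?lexx ?orbT //.
by move=> *; rewrite normrN; exact: sin_max.
Qed.

Lemma controlled_trunc_cot e (g : (int -> R) -> int -> R) : 0 < e -> lipschitz_family g ->
  controlled (fun u i => trunc_cot e (g u i)).
Proof.
move=> e0 lg.
have cs : controlled (fun u i => sin (g u i)).
  exact: (controlled_comp _ 1 1 _ ler01 (@sin_max R) sin_lipschitz).
have cc : controlled (fun u i => cos (g u i)).
  exact: (controlled_comp _ 1 1 _ ler01 (@cos_max R) cos_lipschitz).
apply: controlledM (controlledM _ _ cc cs) _.
by apply: controlled_trunc_inv e0 (controlledM _ _ cs cs).2.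
Qed.

Lemma trunc_invE d s : d <= s -> trunc_inv d s = s^-1.
Proof. by move=> ds; rewrite /trunc_inv max_l. Qed.

Lemma trunc_cotE e t : 0 < e -> e <= sin t ^+ 2 -> trunc_cot e t = cot t.
Proof.
move=> e0 et; rewrite /trunc_cot trunc_invE // /cot; field.
by apply/eqP => s0; move: et; rewrite s0 expr0n /= leNgt e0.
Qed.

Lemma trunc_cot_subpi e t : trunc_cot e (t - pi) = trunc_cot e t.
Proof.
rewrite /trunc_cot.
have -> : sin (t - pi) = - sin t by rewrite sinB cospi sinpi; ring.
have -> : cos (t - pi) = - cos t by rewrite cosB cospi sinpi; ring.
by rewrite sqrrN mulrNN.
Qed.

End truncation.

(** * The truncated system and its global solutions *)

Section truncated_system.
Context {R : realType}.
Variables (L a d e : R) (N : nat).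
Implicit Type x : int -> R.

Definition trunc_interaction x (i : int) : R :=
  \sum_(1 <= j < N.+1 | (j%:Z != i %[mod N%:Z])%Z)
    a * (pi / L * trunc_cot e (pi / L * (x j%:Z - x i))).

Definition trunc_force x (i : int) : R :=
  - (2 / L) * trunc_interaction x i
  + (trunc_inv d (x (i + 1) - x i) - trunc_inv d (x i - x (i - 1)))
  + (a ^+ 2 * trunc_inv d (x (i + 1) - x i) ^+ 3
     - a ^+ 2 * trunc_inv d (x i - x (i - 1)) ^+ 3).

Definition trunc_velocity x (i : int) : R :=
  1 / a * ((trunc_force x (i + 1) - trunc_force x i) * trunc_inv d (x (i + 1) - x i)
    - (trunc_force x i - trunc_force x (i - 1)) * trunc_inv d (x i - x (i - 1))).

Lemma controlled_trunc_velocity : 0 < d -> 0 < e -> controlled trunc_velocity.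
Proof.
move=> d0 e0.
have cp : controlled (fun x i => trunc_inv d (x (i + 1) - x i)).
  apply: controlled_trunc_inv => //.
  under eq_fun do under eq_fun do rewrite -[_ - _]mul1r.
  exact: (lipschitz_difference 1 (fun i => i + 1) id).
have cq : controlled (fun x i => trunc_inv d (x i - x (i - 1))).
  apply: controlled_trunc_inv => //.
  under eq_fun do under eq_fun do rewrite -[_ - _]mul1r.
  exact: (lipschitz_difference 1 id (fun i => i - 1)).
have cube g : @controlled R g -> controlled (fun x i => a ^+ 2 * g x i ^+ 3).
  move=> cg; apply: controlledZ.
  exact: controlledM _ _ cg (controlledM _ _ cg cg).
have cf : controlled trunc_force.
  apply: controlledD (controlledD _ _ (controlledZ _ _ _) (controlledB _ _ cp cq))
    (controlledB _ _ (cube _ cp) (cube _ cq)).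
  apply: (controlled_sum _ (fun j i => (j%:Z != i %[mod N%:Z])%Z)
     (fun j x i => a * (pi / L * trunc_cot e (pi / L * (x j%:Z - x i))))) => j.
  apply: controlledZ; apply: controlledZ; apply: controlled_trunc_cot => //.
  exact: (lipschitz_difference _ (fun=> j%:Z) id).
apply: controlledZ; apply: controlledB.
  exact: controlledM _ _ (controlledB _ _ (controlled_reindex (fun i => i + 1) _ cf) cf) cp.
exact: controlledM _ _ (controlledB _ _ cf (controlled_reindex (fun i => i - 1) _ cf)) cq.
Qed.

Lemma quasi_periodic_gap x : quasi_periodic L N x ->
  forall i j, x (i + N%:Z) - x (j + N%:Z) = x i - x j.
Proof. by move=> xL i j; rewrite !xL; ring. Qed.

Lemma trunc_force_periodic x : L != 0 -> quasi_periodic L N x ->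
  forall i, trunc_force x (i + N%:Z) = trunc_force x i.
Proof.
move=> L0 xL i.
rewrite /trunc_force (addrAC i _ 1) (addrAC i _ (-1)) !(quasi_periodic_gap _ xL).
congr (_ * _ + _ + _); apply: eq_big => [j|j _]; first by rewrite modzDr.
congr (_ * (_ * _)); rewrite xL -[RHS]trunc_cot_subpi; congr trunc_cot; field.
exact: L0.
Qed.

Lemma trunc_velocity_periodic x : L != 0 -> quasi_periodic L N x ->
  forall i, trunc_velocity x (i + N%:Z) = trunc_velocity x i.
Proof.
move=> L0 xL i.
rewrite /trunc_velocity (addrAC i _ 1) (addrAC i _ (-1)).
by rewrite !(quasi_periodic_gap _ xL) !trunc_force_periodic.
Qed.

(** Only the particles [0, ..., N - 1] are read and the others are rebuilt from
them. Evaluated on folded configurations, the truncated velocity is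
[N]-periodic at every argument, so that quasi-periodicity propagates in
time. *)
Definition fold_config x (i : int) : R := x (i %% N%:Z)%Z + (i %/ N%:Z)%Z%:~R * L.

Lemma fold_config_quasi_periodic x : (0 < N)%N -> quasi_periodic L N (fold_config x).
Proof.
move=> N0 i; rewrite /fold_config modzDr divzDr ?dvdzz // divzz.
have -> : (N%:Z != 0) = true by lia.
by rewrite intrD mulrDl mul1r addrA.
Qed.

Lemma quasi_periodic_multiple x : quasi_periodic L N x ->
  forall (q : int) i, x (i + q * N%:Z) = x i + q%:~R * L.
Proof.
move=> xL; have nat_case (n : nat) i : x (i + n%:Z * N%:Z) = x i + n%:R * L.
  elim: n i => [|n IH] i; first by rewrite !mul0r !addr0.
  rewrite intS mulrDl mul1r addrA (IH (i + N%:Z)) xL -natr1; ring.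
case=> n i; first exact: nat_case.
have := nat_case n.+1 (i + Negz n * N%:Z).
rewrite -addrA -mulrDl NegzE addNr mul0r addr0 => ->.
by rewrite mulrNz -pmulrn (mulNr _ L) addrK.
Qed.

Lemma fold_configK x : quasi_periodic L N x -> fold_config x = x.
Proof.
move=> xL; apply/funext => i.
by rewrite /fold_config -(quasi_periodic_multiple _ xL) addrC -divz_eq.
Qed.

(** Each [x (i + N) - x i] has zero derivative, since the velocity of a folded
configuration is periodic. So the solution stays quasi-periodic, and folding
does not change it. *)
Lemma truncated_solution (x0 : int -> R) :
  0 < L -> (0 < N)%N -> 0 < d -> 0 < e -> quasi_periodic L N x0 ->
  exists x : int -> R -> R, exists2 B, 0 <= B &
  [/\ forall i, x i 0 = x0 i,
      forall t, 0 <= t -> quasi_periodic L N (fun i => x i t),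
      forall i (t : R), 0 <= t -> is_derive t 1 (x i) (trunc_velocity (fun j => x j t) i) &
      time_lipschitz B x].
Proof.
move=> L0 N0 d0 e0 x0L.
pose G u := trunc_velocity (fold_config u).
have [[B B0 GB] [K K0 GK]] : controlled G.
  apply: controlled_precomp (controlled_trunc_velocity d0 e0) => u v m uv i.
  by rewrite /fold_config opprD addrACA subrr addr0; exact: uv.
have K1 : 1 <= K + 1 by rewrite lerDr.
have GBK : bounded_lipschitz G B (K + 1).
  split=> // u v m uv i; apply: le_trans (GK _ _ _ uv _) _.
  by rewrite ler_wpM2r ?lerDl // (le_trans _ (uv 0)).
have [x [x_0 dx xB]] := global_picard _ _ _ x0 GBK B0 K1.
have xL t : 0 <= t -> quasi_periodic L N (fun i => x i t).
  move=> t0 i; apply/eqP; rewrite -subr_eq0 -normr_le0.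
  apply: (norm_le_of_derive (fun t => x (i + N%:Z) t - (x i t + L))
    (fun=> 0) (fun=> 0) (fun=> 0) t) => //.
  - move=> s /andP[s0 _].
    have := is_deriveB (dx (i + N%:Z) s s0) (is_deriveD (dx i s s0) (is_derive_cst L s 1)).
    rewrite /G trunc_velocity_periodic ?gt_eqF //; last exact: fold_config_quasi_periodic.
    by rewrite addr0 subrr.
  - by rewrite normr0.
  - by rewrite !x_0 x0L subrr normr0.
exists x, B => //; split=> // i t t0.
by have := dx i t t0; rewrite /G fold_configK //; exact: xL.
Qed.

End truncated_system.

(** * Gaps and sines in a quasi-periodic configuration *)

(** From [z * cos z <= sin z] at [z = y / 2] one gets
[y * (1 + cos y) / 2 <= sin y], and [cos y] is nonnegative. *)
Lemma half_le_sin {R : realType} (y : R) : 0 <= y <= pi / 2 -> y / 2 <= sin y.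
Proof.
move=> /andP[y0 yp]; have pi0 := pi_gt0 R.
have z0 : 0 <= y / 2 by lra.
have zcos : y / 2 * cos (y / 2) <= sin (y / 2).
  have [|c] := @MVT_segment R sin cos 0 (y / 2) z0 (fun t _ => is_derive_sin t).
    exact: continuous_subspaceT (@continuous_sin R).
  rewrite in_itv/= sin0 !subr0 => /andP[c0 cy] ->.
  rewrite mulrC ler_wpM2r //.
  move: cy; rewrite le_eqVlt => /orP[/eqP -> //|cy].
  by apply: ltW; rewrite ltr_cos ?in_itv //=; lra.
have c0 : 0 <= cos (y / 2) by apply: cos_ge0_pihalf; lra.
have -> : sin y = 2 * (sin (y / 2) * cos (y / 2)).
  by rewrite {1}(splitr y) sinD; ring.
have cy : 0 <= cos y by apply: cos_ge0_pihalf; lra.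
have : cos y = 2 * cos (y / 2) ^+ 2 - 1.
  by rewrite {1}(splitr y) cosD -!expr2 sin2cos2; ring.
have := ler_wpM2r c0 zcos.
have := mulr_ge0 y0 cy.
set c := cos (y / 2); set s := sin (y / 2) => h1 h2 h3.
rewrite h3 in h1; have -> : y / 2 = 2 * (y / 2 * c * c) - y * (2 * c ^+ 2 - 1) / 2.
  by field.
lra.
Qed.

Lemma half_le_sin_pi {R : realType} (m y : R) : m <= y <= pi - m -> 0 <= m -> m / 2 <= sin y.
Proof.
move=> /andP[my ym] m0.
have [yp|/ltW yp] := leP y (pi / 2).
  by apply: le_trans (half_le_sin y _); lra.
have -> : sin y = sin (pi - y) by rewrite sinB sinpi cospi; ring.
by apply: le_trans (half_le_sin (pi - y) _); lra.
Qed.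

Lemma sqr_sin_addpi {R : realType} (q : int) (y : R) :
  sin (y + q%:~R * pi) ^+ 2 = sin y ^+ 2.
Proof.
have step z : sin (z + pi) ^+ 2 = sin z ^+ 2 :> R by rewrite sinDpi sqrrN.
have nat_case (n : nat) z : sin (z + n%:R * pi) ^+ 2 = sin z ^+ 2 :> R.
  elim: n z => [|n IH] z; first by rewrite mul0r addr0.
  by rewrite -natr1 mulrDl mul1r addrA step IH.
case: q => n; first exact: nat_case.
rewrite -(nat_case n.+1 (y + _)) NegzE mulrNz -pmulrn; congr (sin _ ^+ 2); ring.
Qed.

Definition gaps_ge {R : realType} (x : int -> R) (m : R) : Prop :=
  forall i, m <= x (i + 1) - x i.

Lemma gap_chain {R : realType} (x : int -> R) (m : R) : 0 <= m -> gaps_ge x m ->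
  forall (n : nat) i, (0 < n)%N -> m <= x (i + n%:Z) - x i.
Proof.
move=> m0 xm; elim=> [//|[|n] IH] i _; first exact: xm.
have := IH i isT; have := xm (i + n.+1%:Z).
have -> : i + n.+1%:Z + 1 = i + n.+2%:Z by lia.
lra.
Qed.

Section geometry.
Context {R : realType}.
Variables (L : R) (N : nat).
Hypotheses (L0 : 0 < L) (N0 : (0 < N)%N).
Implicit Type x : int -> R.

Lemma gaps_from_period x (m : R) : quasi_periodic L N x ->
  (forall i, 1 <= i <= N%:Z -> m <= x (i + 1) - x i) -> gaps_ge x m.
Proof.
move=> xL mi i.
have NZ : 0 < N%:Z :> int by lia.
have r0 := modz_ge0 (i - 1) (lt0r_neq0 NZ).
have rN := ltz_pmod (i - 1) NZ.
have := divz_eq (i - 1) N%:Z.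
move: r0 rN; move: (_ %% _)%Z (_ %/ _)%Z => r q r0 rN /eqP; rewrite subr_eq => /eqP ->.
have -> : q * N%:Z + r + 1 + 1 = (1 + r + 1) + q * N%:Z by ring.
have -> : q * N%:Z + r + 1 = (1 + r) + q * N%:Z by ring.
rewrite !(quasi_periodic_multiple _ _ _ xL) opprD addrACA subrr addr0.
by apply: mi; lia.
Qed.

Lemma gap_le_period x (m : R) : 0 <= m -> quasi_periodic L N x -> gaps_ge x m ->
  forall i, x (i + 1) - x i <= L.
Proof.
move=> m0 xL xm i.
have x0 : gaps_ge x 0 by move=> j; exact: le_trans (xm j).
have : x (i + 1) <= x (i + N%:Z).
  case: N N0 => [//|[|n] _]; first exact: lexx.
  have := gap_chain _ _ (lexx 0) x0 n.+1 (i + 1) isT.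
  have -> : i + 1 + n.+1%:Z = i + n.+2%:Z by lia.
  by rewrite subr_ge0.
by rewrite xL; lra.
Qed.

(** Modulo the period [L], the gap between two distinct particles lies between
[m] and [L - m]; on the corresponding range of angles the sine is at least half
the distance to its zeros, and [pi / 2 >= 1]. *)
Lemma sqr_sin_ge x (m : R) : 0 <= m -> quasi_periodic L N x -> gaps_ge x m ->
  forall i j : int, (j != i %[mod N%:Z])%Z ->
  (m / L) ^+ 2 <= sin (pi / L * (x j - x i)) ^+ 2.
Proof.
move=> m0 xL xm i j; rewrite eqz_mod_dvd => ji.
have NZ : 0 < N%:Z :> int by lia.
have r0 := modz_ge0 (j - i) (lt0r_neq0 NZ).
have rN := ltz_pmod (j - i) NZ.
have rn0 : ((j - i) %% N%:Z)%Z != 0 by apply: contra ji => /eqP/dvdz_mod0P.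
have jE : j = i + ((j - i) %% N%:Z)%Z + ((j - i) %/ N%:Z)%Z * N%:Z.
  by rewrite -addrA (addrC (_ %% _)%Z) -divz_eq; ring.
move: jE r0 rN rn0; move: (_ %% _)%Z (_ %/ _)%Z => r q -> r0 rN rn0.
rewrite (quasi_periodic_multiple _ _ _ xL).
have -> : pi / L * (x (i + r) + q%:~R * L - x i) = pi / L * (x (i + r) - x i) + q%:~R * pi.
  by field; rewrite gt_eqF.
rewrite sqr_sin_addpi.
case: r r0 rN rn0 => [r _ rN rn0|//].
have lo := gap_chain _ _ m0 xm r i ltac:(lia).
have hi := gap_chain _ _ m0 xm (N - r) (i + r%:Z) ltac:(lia).
have iN : i + r%:Z + (N - r)%N%:Z = i + N%:Z by lia.
rewrite iN xL in hi.
have pi2 := @pi_ge2 R.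
have piL : 0 < pi / L :> R by rewrite divr_gt0 // pi_gt0.
have : pi / L * m / 2 <= sin (pi / L * (x (i + r%:Z) - x i)).
  apply: half_le_sin_pi; last by rewrite mulr_ge0 // ltW.
  rewrite ler_wpM2l ?(ltW piL) //=.
  have -> : pi - pi / L * m = pi / L * (L - m) by field; rewrite gt_eqF.
  by rewrite ler_wpM2l ?(ltW piL) //; lra.
have mL : 0 <= m / L by rewrite divr_ge0 // ltW.
have : m / L <= pi / L * m / 2.
  have -> : pi / L * m / 2 = m / L * (pi / 2) by field; rewrite gt_eqF.
  by rewrite ler_peMr //; lra.
move=> h1 h2; rewrite ler_sqr ?nnegrE //; first exact: le_trans h1 h2.
by apply: le_trans mL _; apply: le_trans h1 h2.
Qed.

Lemma exists_least_gap x : quasi_periodic L N x ->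
  exists2 k : nat, (1 <= k <= N)%N & gaps_ge x (x (k%:Z + 1) - x k%:Z).
Proof.
move=> xL; pose f (k : 'I_N) := x (k.+1%:Z + 1) - x k.+1%:Z.
have [k _ kmin] := @arg_minP _ R 'I_N (Ordinal N0) xpredT f isT.
exists k.+1; first exact: ltn_ord.
apply: (gaps_from_period x) => // -[[|i]|//] // /andP[_ iN].
have iN' : (i < N)%N by lia.
exact: (kmin (Ordinal iN') isT).
Qed.

End geometry.

(** * The energy and its dissipation *)

Section energy.
Context {R : realType}.
Variables (L a : R) (N : nat).
Hypotheses (L0 : 0 < L) (N0 : (0 < N)%N) (a0 : 0 < a).
Implicit Type x : int -> R.

Definition gap_energy x (i : int) : R :=
  - ln (x (i + 1) - x i) + a ^+ 2 / 2 * (x (i + 1) - x i)^-1 ^+ 2.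

(** The square turns the logarithm of an absolute value into a smooth function,
at the price of a factor 2. *)
Definition pair_energy x (i j : int) : R := ln (sin (pi / L * (x j - x i)) ^+ 2).

(** The potential whose partial derivative in [x i] is [force i]. The double sum
visits every pair twice and [pair_energy] carries a factor 2, whence the
coefficient [a / (2 * L)] in place of [2 * a / L]. *)
Definition energy x : R :=
  \sum_(1 <= i < N.+1) gap_energy x i%:Z
  + a / (2 * L) * \sum_(1 <= i < N.+1)
      \sum_(1 <= j < N.+1 | (j%:Z != i%:Z %[mod N%:Z])%Z) pair_energy x i%:Z j%:Z.

Lemma sumr_periodic_shift (c : int -> R) : (forall i, c (i + N%:Z) = c i) ->
  \sum_(1 <= i < N.+1) c (i%:Z + 1) = \sum_(1 <= i < N.+1) c i%:Z.
Proof.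
move=> cN; apply/eqP; rewrite -subr_eq0 -sumrB.
have -> : \sum_(1 <= i < N.+1) (c (i%:Z + 1) - c i%:Z) =
    \sum_(1 <= i < N.+1) ((fun k : nat => c k%:Z) i.+1 - (fun k : nat => c k%:Z) i).
  by apply: eq_bigr => i _ /=; rewrite intS (addrC 1).
rewrite (@telescope_sumr _ _ _ (fun k : nat => c k%:Z)) //= -(cN 1) intS.
by rewrite subrr.
Qed.

Lemma summation_by_parts (p v : int -> R) :
  (forall i, p (i + N%:Z) = p i) -> (forall i, v (i + N%:Z) = v i) ->
  \sum_(1 <= i < N.+1) p i%:Z * (v (i%:Z + 1) - v i%:Z) =
  - \sum_(1 <= i < N.+1) (p i%:Z - p (i%:Z - 1)) * v i%:Z.
Proof.
move=> pN vN; pose c k := p (k - 1) * v k.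
apply/eqP; rewrite -subr_eq0 opprK -big_split /=.
rewrite (eq_bigr (fun i : nat => c (i%:Z + 1) - c i%:Z)); last first.
  by move=> i _; rewrite /c addrK; ring.
rewrite sumrB sumr_periodic_shift ?subrr // => i.
by rewrite /c addrAC pN vN.
Qed.

Lemma antisymmetric_sum (P : rel nat) (c : nat -> nat -> R) (v : nat -> R) :
  (forall i j, P i j = P j i) -> (forall i j, c j i = - c i j) ->
  \sum_(1 <= i < N.+1) \sum_(1 <= j < N.+1 | P j i) c i j * (v j - v i) =
  - 2 * \sum_(1 <= i < N.+1) (\sum_(1 <= j < N.+1 | P j i) c i j) * v i.
Proof.
move=> Ps cs.
have swap : \sum_(1 <= i < N.+1) \sum_(1 <= j < N.+1 | P j i) c i j * v j =
    - \sum_(1 <= i < N.+1) \sum_(1 <= j < N.+1 | P j i) c i j * v i.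
  rewrite (exchange_big_dep predT) //= -sumrN; apply: eq_bigr => i _.
  rewrite -sumrN; apply: eq_big => [j|j _]; first by rewrite Ps.
  by rewrite cs mulNr.
have -> : \sum_(1 <= i < N.+1) (\sum_(1 <= j < N.+1 | P j i) c i j) * v i =
    \sum_(1 <= i < N.+1) \sum_(1 <= j < N.+1 | P j i) c i j * v i.
  by apply: eq_bigr => i _; rewrite mulr_suml.
transitivity (\sum_(1 <= i < N.+1) (\sum_(1 <= j < N.+1 | P j i) c i j * v j
   - \sum_(1 <= j < N.+1 | P j i) c i j * v i)).
  by apply: eq_bigr => i _; rewrite -sumrB; apply: eq_bigr => j _; ring.
by rewrite sumrB swap; ring.
Qed.

Lemma is_derive_bigsum (r : seq nat) (P : pred nat) (f : nat -> R -> R)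
    (df : nat -> R) (t : R) :
  (forall i, P i -> is_derive t 1 (f i) (df i)) ->
  is_derive t 1 (fun s => \sum_(i <- r | P i) f i s) (\sum_(i <- r | P i) df i).
Proof.
move=> dfi; elim: r => [|k r IH].
  under eq_fun do rewrite big_nil.
  by rewrite big_nil; exact: is_derive_cst.
under eq_fun do rewrite big_cons.
rewrite big_cons; case: ifP => // Pk.
exact: is_deriveD (dfi k Pk) IH.
Qed.

Lemma is_derive_gap_energy (x : int -> R -> R) (v : int -> R) (t : R) i :
  (forall j, is_derive t 1 (x j) (v j)) -> 0 < x (i + 1) t - x i t ->
  is_derive t 1 (fun s => gap_energy (fun j => x j s) i)
    ((- (x (i + 1) t - x i t)^-1 - a ^+ 2 * (x (i + 1) t - x i t) ^- 3)
     * (v (i + 1) - v i)).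
Proof.
move=> dx h0.
have dh : is_derive t 1 (fun s => x (i + 1) s - x i s) (v (i + 1) - v i).
  exact: (is_deriveB (dx (i + 1)) (dx i)).
pose h s := x (i + 1) s - x i s.
have dln := is_deriveN (@is_derive1_comp _ (@ln R) h t _ _ (is_derive1_ln h0) dh).
have hn0 : x (i + 1) t - x i t != 0 by rewrite gt_eqF.
have dV := is_deriveZ (a ^+ 2 / 2) (is_deriveX 2 (@is_deriveV _ h t _ 1 hn0 dh)).
have := is_deriveD dln dV; rewrite /GRing.scale /=.
set l := (X in is_derive _ _ _ X); set l' := (X in _ -> is_derive _ _ _ X).
have -> : l = l' by rewrite /l /l' /h; field.
exact.
Qed.

Lemma is_derive_pair_energy (x : int -> R -> R) (v : int -> R) (t : R) i j :
  (forall j, is_derive t 1 (x j) (v j)) -> 0 < sin (pi / L * (x j t - x i t)) ^+ 2 ->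
  is_derive t 1 (fun s => pair_energy (fun k => x k s) i j)
    (2 * (pi / L * cot (pi / L * (x j t - x i t))) * (v j - v i)).
Proof.
move=> dx s0.
pose y s := pi / L * (x j s - x i s).
have dy : is_derive t 1 y (pi / L * (v j - v i)).
  exact: (is_deriveZ (pi / L) (is_deriveB (dx j) (dx i))).
have dsin := @is_derive1_comp _ (@sin R) y t _ _ (is_derive_sin _) dy.
pose q s := sin (y s) ^+ 2.
have dq : is_derive t 1 q _ := is_deriveX 2 dsin.
have := @is_derive1_comp _ (@ln R) q t _ _ (is_derive1_ln s0) dq.
have yn0 : sin (y t) != 0 by apply: contraTneq s0 => h; rewrite -/(y t) h expr0n ltxx.
rewrite /GRing.scale /=.
set l := (X in is_derive _ _ _ X); set l' := (X in _ -> is_derive _ _ _ X).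
have -> : l = l'.
  by rewrite /l /l' /q /cot -/(y t); field; rewrite yn0 (lt0r_neq0 L0).
exact.
Qed.

Lemma trunc_forceE (d e : R) x : 0 < d -> 0 < e -> gaps_ge x d ->
  (forall i j : int, (j != i %[mod N%:Z])%Z -> e <= sin (pi / L * (x j - x i)) ^+ 2) ->
  trunc_force L a d e N x = force L a N x.
Proof.
move=> d0 e0 xd xe; apply/funext => i.
rewrite /trunc_force /force; have := xd (i - 1); rewrite subrK => xi.
rewrite !trunc_invE //; congr (_ * _ + _ + _); rewrite ?div1r ?exprVn //.
by apply: eq_bigr => j ji; rewrite trunc_cotE // xe.
Qed.

Lemma trunc_velocityE (d e : R) x : 0 < d -> 0 < e -> gaps_ge x d ->
  (forall i j : int, (j != i %[mod N%:Z])%Z -> e <= sin (pi / L * (x j - x i)) ^+ 2) ->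
  trunc_velocity L a d e N x = velocity L a N x.
Proof.
move=> d0 e0 xd xe; apply/funext => i.
rewrite /trunc_velocity /velocity (trunc_forceE d e) //.
by have := xd (i - 1); rewrite subrK => xi; rewrite !trunc_invE.
Qed.


Lemma cot_opp (z : R) : cot (- z) = - cot z.
Proof. by rewrite /cot cosN sinN invrN mulrN. Qed.

(** Summation by parts moves the discrete derivative from [v] to the gap terms,
and the oddness of the cotangent collapses the double sum over pairs. *)
Lemma is_derive_energy (x : int -> R -> R) (v : int -> R) (t m : R) :
  (forall j, is_derive t 1 (x j) (v j)) ->
  (forall j, v (j + N%:Z) = v j) ->
  quasi_periodic L N (fun j => x j t) -> 0 < m -> gaps_ge (fun j => x j t) m ->
  is_derive t 1 (fun s => energy (fun j => x j s))
    (\sum_(1 <= i < N.+1) force L a N (fun j => x j t) i%:Z * v i%:Z).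
Proof.
move=> dx vN xL m0 xm; pose X j := x j t.
pose p i := - (X (i + 1) - X i)^-1 - a ^+ 2 * (X (i + 1) - X i) ^- 3.
pose c (i j : nat) := 2 * (pi / L * cot (pi / L * (X j%:Z - X i%:Z))).
have sin_gt0 i j : (j != i %[mod N%:Z])%Z -> 0 < sin (pi / L * (X j - X i)) ^+ 2.
  move=> ji; apply: lt_le_trans (sqr_sin_ge L N L0 N0 X m (ltW m0) xL xm i j ji).
  by rewrite exprn_gt0 // divr_gt0.
have dE : is_derive t 1 (fun s => energy (fun j => x j s))
  (\sum_(1 <= i < N.+1) p i%:Z * (v (i%:Z + 1) - v i%:Z) + a / (2 * L) *
   \sum_(1 <= i < N.+1) \sum_(1 <= j < N.+1 | (j%:Z != i%:Z %[mod N%:Z])%Z)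
      c i j * (v j%:Z - v i%:Z)).
  apply: is_deriveD.
    apply: is_derive_bigsum => i _; apply: is_derive_gap_energy => //.
    exact: lt_le_trans m0 (xm i).
  apply: is_deriveZ; apply: is_derive_bigsum => i _; apply: is_derive_bigsum => j ji.
  by apply: is_derive_pair_energy => //; exact: sin_gt0.
apply: (is_derive_eq dE).
have pN i : p (i + N%:Z) = p i.
  by rewrite /p (addrAC i _ 1) (quasi_periodic_gap _ _ _ xL).
rewrite (summation_by_parts _ _ pN vN).
rewrite (antisymmetric_sum (fun j i => (j%:Z != i%:Z %[mod N%:Z])%Z) c (fun i => v i%:Z)).
- rewrite mulrA mulr_sumr -sumrN -big_split /=; apply: eq_bigr => i _.
  rewrite mulrA -mulNr -mulrDl; congr (_ * _).
  rewrite /force /interaction_sum /c -!mulr_sumr.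
  rewrite /p subrK -/(X i%:Z) -/(X (i%:Z + 1)) -/(X (i%:Z - 1)).
  set S := \sum_(_ <= _ < _ | _) _.
  have h1 := lt0r_neq0 (lt_le_trans m0 (xm i%:Z)).
  have := lt0r_neq0 (lt_le_trans m0 (xm (i%:Z - 1))); rewrite subrK => h2.
  field.
  by rewrite (lt0r_neq0 L0) h1 h2.
- by move=> i j; rewrite eq_sym.
- by move=> i j; rewrite /c -(opprB (X j%:Z)) mulrN cot_opp; ring.
Qed.

(** Where no gap is below [m] the force coincides with a truncated force, for
which periodicity holds without any ordering. *)
Lemma force_periodic x (m : R) : quasi_periodic L N x -> 0 < m -> gaps_ge x m ->
  forall i, force L a N x (i + N%:Z) = force L a N x i.
Proof.
move=> xL m0 xm i.
have e0 : 0 < (m / L) ^+ 2 by rewrite exprn_gt0 // divr_gt0.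
rewrite -(trunc_forceE m ((m / L) ^+ 2)) //; last first.
  exact: sqr_sin_ge L N L0 N0 x m (ltW m0) xL xm.
exact: trunc_force_periodic _ _ _ _ _ _ (lt0r_neq0 L0) xL i.
Qed.

(** The velocity is [a^-1] times the discrete divergence of the flux
[(f (i + 1) - f i) / (x (i + 1) - x i)], so summation by parts gives
[- a^-1] times the sum of [(f (i + 1) - f i) ^+ 2 / (x (i + 1) - x i)]. *)
Lemma energy_dissipation x (m : R) : quasi_periodic L N x -> 0 < m -> gaps_ge x m ->
  \sum_(1 <= i < N.+1) force L a N x i%:Z * velocity L a N x i%:Z <= 0.
Proof.
move=> xL m0 xm; pose f := force L a N x.
have fN : forall i, f (i + N%:Z) = f i := force_periodic x m xL m0 xm.
pose p i := (f (i + 1) - f i) / (x (i + 1) - x i).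
have pN i : p (i + N%:Z) = p i.
  by rewrite /p (addrAC i _ 1) (quasi_periodic_gap _ _ _ xL) !fN.
have -> : \sum_(1 <= i < N.+1) force L a N x i%:Z * velocity L a N x i%:Z
    = a^-1 * \sum_(1 <= i < N.+1) (p i%:Z - p (i%:Z - 1)) * f i%:Z.
  rewrite mulr_sumr; apply: eq_bigr => i _.
  rewrite /velocity -/f /p subrK; ring.
rewrite pmulr_rle0 ?invr_gt0 // -oppr_ge0 -summation_by_parts //.
apply: sumr_ge0 => i _; rewrite /p mulrAC -expr2 divr_ge0 ?sqr_ge0 //.
by apply: ltW; exact: lt_le_trans m0 (xm _).
Qed.

End energy.

(** * The energy controls the gaps *)

Section bound.
Context {R : realType}.
Variables (L a : R) (N : nat).
Hypotheses (L0 : 0 < L) (N0 : (0 < N)%N) (a0 : 0 < a).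
Implicit Type x : int -> R.

(** An upper bound for the positive solutions [z] of
[a ^+ 2 / 2 * z ^+ 2 <= C0 + C1 * z] is [1 + 2 * (C0 + C1) / a ^+ 2]; here [z]
is the inverse of the smallest gap and the constants come from
[energy_lower_bound]. *)
Definition min_gap (E0 : R) : R :=
  (1 + 2 * (`|E0| + N%:R * L + a * N%:R ^+ 2) / a ^+ 2)^-1.

Lemma min_gap_gt0 E0 : 0 < min_gap E0.
Proof.
rewrite invr_gt0 ltr_wpDr // divr_ge0 ?sqr_ge0 // mulr_ge0 // !addr_ge0 //.
  by rewrite mulr_ge0 // ltW.
by rewrite mulr_ge0 ?sqr_ge0 // ltW.
Qed.

(** The repulsion [a ^+ 2 / (2 h ^+ 2)] of the smallest gap alone beats all the
attractive terms: the logarithms of the gaps are at most [L] each, and each of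
the at most [N ^+ 2] pair terms is bounded below by minus the logarithm of
[(L / m) ^+ 2], hence by [- 2 * L / m]. *)
Lemma energy_lower_bound x (m : R) (k : nat) :
  quasi_periodic L N x -> 0 < m -> gaps_ge x m ->
  (1 <= k <= N)%N -> x (k%:Z + 1) - x k%:Z = m ->
  a ^+ 2 / 2 * m^-1 ^+ 2 - N%:R * L - a * N%:R ^+ 2 * m^-1 <= energy L a N x.
Proof.
move=> xL m0 xm kN km.
have gapE : a ^+ 2 / 2 * m^-1 ^+ 2 - N%:R * L <= \sum_(1 <= i < N.+1) gap_energy a x i%:Z.
  have -> : a ^+ 2 / 2 * m^-1 ^+ 2 - N%:R * L =
     \sum_(1 <= i < N.+1) ((if i == k then a ^+ 2 / 2 * m^-1 ^+ 2 else 0) - L).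
    by rewrite sumrB -big_mkcond big_nat1_eq ltnS kN sumr_const_nat subn1 /= mulr_natl.
  apply: ler_sum => i _; have h0 := lt_le_trans m0 (xm i).
  have hL := gap_le_period L N L0 N0 x m (ltW m0) xL xm i.
  have lnh := ln_sublinear h0.
  rewrite /gap_energy; case: eqP => [ik|_]; first by move: lnh hL; rewrite ik km; lra.
  have : 0 <= a ^+ 2 / 2 * (x (i%:Z + 1) - x i%:Z)^-1 ^+ 2.
    by rewrite mulr_ge0 ?sqr_ge0 // divr_ge0 ?sqr_ge0.
  lra.
have pairE i j : (j != i %[mod N%:Z])%Z -> - (2 * L * m^-1) <= pair_energy L x i j.
  move=> ji; have s0 := sqr_sin_ge L N L0 N0 x m (ltW m0) xL xm i j ji.
  have q0 : 0 < L / m by rewrite divr_gt0.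
  apply: (@le_trans _ _ (ln ((m / L) ^+ 2))); last first.
    by rewrite ler_ln // posrE ?(lt_le_trans _ s0) // exprn_gt0 // divr_gt0.
  have -> : m / L = (L / m)^-1 by rewrite invf_div.
  rewrite exprVn lnV ?posrE ?exprn_gt0 // lerN2 lnXn // -mulrA -[leLHS]mulr_natl.
  by rewrite ler_wpM2l // ltW // ln_sublinear.
rewrite /energy lerD //.
rewrite [leLHS](_ : _ = a / (2 * L) * - (N%:R ^+ 2 * (2 * L * m^-1)));
  last first.
  by field; rewrite !lt0r_neq0.
rewrite ler_wpM2l ?divr_ge0 ?mulr_ge0 ?(ltW L0) ?(ltW a0) //.
have -> : - (N%:R ^+ 2 * (2 * L * m^-1)) =
    \sum_(1 <= i < N.+1) \sum_(1 <= j < N.+1) - (2 * L * m^-1).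
  rewrite !sumr_const_nat subn1 /= -mulrnA -[RHS]mulr_natl natrM; ring.
apply: ler_sum => i _; rewrite [leRHS]big_mkcond; apply: ler_sum => j _.
case: ifP => [/pairE//|_].
by rewrite oppr_le0 mulr_ge0 ?invr_ge0 ?mulr_ge0 ?ltW.
Qed.

Lemma gaps_of_energy_le x (E0 : R) : quasi_periodic L N x ->
  (forall i, x i < x (i + 1)) -> energy L a N x <= E0 -> gaps_ge x (min_gap E0).
Proof.
move=> xL x_inc xE.
have [k kN xm] := exists_least_gap L N L0 N0 _ xL; set m := _ - _ in xm.
have m0 : 0 < m by rewrite subr_gt0.
have := le_trans (energy_lower_bound _ _ k xL m0 xm kN erefl) xE.
suff h : a ^+ 2 / 2 * m^-1 ^+ 2 - N%:R * L - a * N%:R ^+ 2 * m^-1 <= E0 ->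
    min_gap E0 <= m.
  by move=> /h mm i; exact: le_trans mm (xm i).
move: m m0 {xm} => m m0; set z := m^-1 => zE.
rewrite -(invrK m) -/z.
have z0 : 0 < z by rewrite invr_gt0.
have W0 := min_gap_gt0 E0.
rewrite /min_gap in W0 *; rewrite invr_gt0 in W0.
rewrite lef_pV2 ?posrE //.
have C0 : 0 <= N%:R * L by rewrite mulr_ge0 // ltW.
have C1 : 0 <= a * N%:R ^+ 2 by rewrite mulr_ge0 ?sqr_ge0 // ltW.
have EE := ler_norm E0; have E_ge0 := normr_ge0 E0.
have a2 : 0 < a ^+ 2 by rewrite exprn_gt0.
set C := `|E0| + N%:R * L + a * N%:R ^+ 2.
have CC : 0 <= C by rewrite !addr_ge0.
have [z1|z1] := leP z 1.
  by apply: le_trans z1 _; rewrite lerDl divr_ge0 ?sqr_ge0 // mulr_ge0.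
apply: (@le_trans _ _ (2 * C / a ^+ 2)); last by rewrite lerDr.
rewrite ler_pdivlMr // -(ler_pM2l z0).
have h1 : `|E0| + N%:R * L <= (`|E0| + N%:R * L) * z by rewrite ler_peMr ?addr_ge0 // ltW.
rewrite /C; lra.
Qed.

End bound.

(** * Propagation of the gap bound and global existence *)

Lemma has_derivative_in_of_derive {R : realType} (D : set R) (f : R -> R) (t l : R) :
  is_derive t 1 f l -> has_derivative_in D f t l.
Proof.
move=> [df <-]; rewrite /has_derivative_in.
apply: cvg_within_filter.
apply/cvgrPdist_le => e e0.
have /cvgrPdist_le/(_ _ e0) := df.
rewrite /derive; set d := lim _; rewrite !near_withinE /= => -[r /= r0 rP].
near=> s => st.
have := rP (s - t); rewrite /= sub0r normrN subr_eq0 /GRing.scale /= mulr1 subrK mulrC.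
apply => //; near: s; apply: nbhsx_ballx => //.
Unshelve. all: by end_near. Qed.

Section continuation.
Context {R : realType}.
Variables (L a : R) (N : nat).
Hypotheses (L0 : 0 < L) (N0 : (0 < N)%N) (a0 : 0 < a).

(** A bootstrap in time steps of fixed length [tau]. Energy at most [E0] forces
the gaps to be at least [2 * d]. Gaps vary at rate at most [2 * B], so over a
step [tau] they stay above [d]; up to there the truncation is not felt, the
energy has not increased, and the gaps are again at least [2 * d]. The
threshold [(d / L) ^+ 2] for squared sines is the one guaranteed by
[sqr_sin_ge] for gaps at least [d]. *)
Lemma gaps_persist (x : int -> R -> R) (B E0 : R)
    (d := min_gap L a N E0 / 2) :
  0 <= B ->
  (forall i, x i 0 < x (i + 1) 0) ->
  energy L a N (fun i => x i 0) <= E0 ->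
  (forall t, 0 <= t -> quasi_periodic L N (fun i => x i t)) ->
  (forall i (t : R), 0 <= t -> is_derive t 1 (x i)
     (trunc_velocity L a d ((d / L) ^+ 2) N (fun j => x j t) i)) ->
  time_lipschitz B x ->
  forall t, 0 <= t -> gaps_ge (fun i => x i t) d.
Proof.
move=> B0 x_inc xE xL dx xB; pose d2 := min_gap L a N E0.
have dE : d = d2 / 2 by [].
have d20 : 0 < d2 by exact: min_gap_gt0.
have d0 : 0 < d by rewrite dE; lra.
clearbody d.
have e0 : 0 < (d / L) ^+ 2 by rewrite exprn_gt0 // divr_gt0.
have true_velocity t : 0 <= t -> gaps_ge (fun i => x i t) d ->
    trunc_velocity L a d ((d / L) ^+ 2) N (fun j => x j t) =
    velocity L a N (fun j => x j t).
  move=> t0 xd; apply: trunc_velocityE => //.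
  exact: sqr_sin_ge L N L0 N0 _ d (ltW d0) (xL t t0) xd.
have improve t : 0 <= t -> (forall s, 0 <= s <= t -> gaps_ge (fun i => x i s) d) ->
    gaps_ge (fun i => x i t) d2.
  move=> t0 xd; apply: (gaps_of_energy_le L a N L0 N0 a0) => //.
  - exact: xL.
  - move=> i; rewrite -subr_gt0; apply: lt_le_trans d0 (xd t _ i).
    by rewrite t0 lexx.
  apply: le_trans xE; rewrite -lerN2.
  apply: (@ndecr_of_derive R (fun s => - energy L a N (fun i => x i s))
    (fun s => - \sum_(1 <= i < N.+1) force L a N (fun j => x j s) i%:Z *
              velocity L a N (fun j => x j s) i%:Z) 0 t t0) => s st; have /andP[s0 _] := st.
    apply: is_deriveN; apply: (is_derive_energy L a N L0 N0 _ _ _ d) => //.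
    - by move=> j; rewrite -true_velocity //; [exact: dx|exact: xd].
    - move=> j; rewrite -true_velocity //; last exact: xd.
      by apply: trunc_velocity_periodic; [exact: lt0r_neq0|exact: xL].
    - exact: xL.
    - exact: xd.
  rewrite oppr_ge0; apply: (energy_dissipation L a N L0 N0 a0 _ d) => //.
    exact: xL.
  exact: xd.
pose tau := d / (2 * B + 1).
have tau0 : 0 < tau by rewrite divr_gt0 //; lra.
have Btau : 2 * B * tau <= d.
  rewrite /tau mulrCA ler_piMr ?(ltW d0) // ler_pdivrMr; lra.
have steps (n : nat) t : 0 <= t <= n%:R * tau -> gaps_ge (fun i => x i t) d2.
  elim: n t => [|n IH] t /andP[t0 tn]; apply: improve => // s /andP[s0 st] i.
    have -> : s = 0 by rewrite mul0r in tn; lra.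
    have := gaps_of_energy_le L a N L0 N0 a0 (fun i => x i 0) _ (xL 0 (lexx 0)) x_inc xE i.
    by rewrite -/d2; lra.
  have [sn|sn] := leP s (n%:R * tau).
    by have := IH s _ i; rewrite s0 sn => /(_ isT); lra.
  have n0 : 0 <= n%:R * tau by rewrite mulr_ge0 // ltW.
  have := IH (n%:R * tau) _ i; rewrite n0 lexx => /(_ isT).
  have := xB i s (n%:R * tau) s0 n0; have := xB (i + 1) s (n%:R * tau) s0 n0.
  have sd : `|s - n%:R * tau| <= tau.
    rewrite ger0_norm; last by rewrite subr_ge0 ltW.
    by rewrite -natr1 in tn; lra.
  have := ler_wpM2l B0 sd.
  by rewrite !ler_norml => h0 /andP[h1 h2] /andP[h3 h4] h5; lra.
move=> t t0 i.
have : gaps_ge (fun i => x i t) d2.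
  apply: (steps (Num.truncn (t / tau)).+1); rewrite t0 /=.
  rewrite -ler_pdivrMr // ltW //.
  by rewrite truncnS_gt.
by move=> /(_ i); lra.
Qed.

End continuation.

Theorem proposition4p1 (R : realType) (L : R) (L_gt0 : 0 < L)
    (N : nat) (N_ge2 : (2 <= N)%N)
    (x0 : int -> R) (x0_per : quasi_periodic L N x0) (x0_ord : ordered N x0) :
  exists x : int -> R -> R, global_solution L (1 / N%:R) N x0 x.
Proof.
have N0 : (0 < N)%N by exact: ltnW.
have a0 : 0 < 1 / N%:R :> R by rewrite divr_gt0 // ltr0n.
set a := 1 / N%:R in a0 *.
have x0_inc i : x0 i < x0 (i + 1).
  have [k kN xm] := exists_least_gap L N L_gt0 N0 _ x0_per.
  rewrite -subr_gt0; apply: lt_le_trans (xm i).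
  by rewrite subr_gt0; apply: x0_ord; lia.
pose d := min_gap L a N (energy L a N x0) / 2.
have d0 : 0 < d by rewrite divr_gt0 // min_gap_gt0.
have e0 : 0 < (d / L) ^+ 2 by rewrite exprn_gt0 // divr_gt0.
have [x [B B0 [x_0 xL dx xB]]] := truncated_solution L a d _ N x0 L_gt0 N0 d0 e0 x0_per.
have x_at0 : (fun i => x i 0) = x0 by apply/funext.
have gaps : forall t, 0 <= t -> gaps_ge (fun i => x i t) d.
  apply: (gaps_persist L a N L_gt0 N0 a0 x B (energy L a N x0)) => //.
    by move=> i; rewrite !x_0.
  by rewrite x_at0.
exists x; split=> // [t t0 i _|t i t0 _].
  by rewrite -subr_gt0; exact: lt_le_trans d0 (gaps t t0 i).
apply: has_derivative_in_of_derive.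
rewrite -(trunc_velocityE L a N d ((d / L) ^+ 2)) //; [exact: dx|exact: gaps|].
exact: sqr_sin_ge L N L_gt0 N0 _ d (ltW d0) (xL t t0) (gaps t t0).
Qed.
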